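(* Consider the system of second-order differential equations $\ddot x={\mathbf A}\dot x+{\mathbf B}x$, $x\in{\mathbb R}^n$, with real $n\times n$ matrices ${\mathbf A},{\mathbf B}$. If ${\mathbf A}$ is diagonally stable and ${\mathbf B}$ is negative diagonal, then the system is $D$-stable.
   Context: A real $n\times n$ matrix ${\mathbf A}$ is diagonally stable if ${\mathbf D}{\mathbf A}+{\mathbf A}^T{\mathbf D}$ is negative definite for some diagonal ${\mathbf D}$ with positive diagonal entries. Negative diagonal means diagonal with all diagonal entries negative. The system $\ddot x={\mathbf A}\dot x+{\mathbf B}x$ is (multiplicative) $D$-stable if the system $\ddot x={\mathbf D}({\mathbf A}\dot x+{\mathbf B}x)$ is asymptotically (Lyapunov) stable for every diagonal ${\mathbf D}$ with positive diagonal entries. A system $\ddot x={\mathbf A}\dot x+{\mathbf B}x$ is asymptotically stable if and only if all eigenvalues of $\begin{pmatrix}{\mathbf A}&{\mathbf B}\\ {\mathbf I}&{\mathbf O}\end{pmatrix}$ have negative real parts. *)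

(* Defs.v *)
From mathcomp Require Import all_boot all_order all_algebra.
From mathcomp Require Import all_classical all_reals all_analysis.

Set Implicit Arguments.
Unset Strict Implicit.
Unset Printing Implicit Defensive.

Import Order.TTheory GRing.Theory Num.Theory.
Import numFieldNormedType.Exports.

Local Open Scope classical_set_scope.
Local Open Scope ring_scope.

Definition positive_diagonal (R : realType) (n : nat) (D : 'M[R]_n) : Prop :=
  is_diag_mx D /\ forall i, 0 < D i i.

Definition negative_diagonal (R : realType) (n : nat) (D : 'M[R]_n) : Prop :=
  is_diag_mx D /\ forall i, D i i < 0.

Definition negative_definite (R : realType) (n : nat) (M : 'M[R]_n) : Prop :=
  M^T = M /\ forall v : 'cV[R]_n, v != 0 -> (v^T *m M *m v) 0 0 < 0.

Definition diagonally_stable (R : realType) (n : nat) (A : 'M[R]_n) : Prop :=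
  exists D : 'M[R]_n,
    positive_diagonal D /\ negative_definite (D *m A + A^T *m D).

(* Solutions of x'' = A x' + B x.  They are taken on the whole time axis: the
   system is linear and autonomous, so every solution on [0, +oo[ is the
   restriction of one defined on R. *)
Definition solution (R : realType) (n : nat) (A B : 'M[R]_n)
    (x : R -> 'cV[R]_n) : Prop :=
  forall t : R, [/\ derivable x t 1, derivable (derive1 x) t 1 &
    derive1 (derive1 x) t = A *m derive1 x t + B *m x t].

(* Point of the phase space; on the product, the norm is the maximum of the
   norms of the position and of the velocity. *)
Definition phase (R : realType) (n : nat) (x : R -> 'cV[R]_n) (t : R) :
  'cV[R]_n * 'cV[R]_n := (x t, derive1 x t).

Definition lyapunov_stable (R : realType) (n : nat) (A B : 'M[R]_n) : Prop :=
  forall eps : R, 0 < eps -> exists2 delta : R, 0 < delta &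
    forall x : R -> 'cV[R]_n, solution A B x -> `|phase x 0| < delta ->
    forall t : R, 0 <= t -> `|phase x t| < eps.

Definition attractive (R : realType) (n : nat) (A B : 'M[R]_n) : Prop :=
  exists2 delta : R, 0 < delta &
    forall x : R -> 'cV[R]_n, solution A B x -> `|phase x 0| < delta ->
    phase x t @[t --> +oo] --> (0 : 'cV[R]_n * 'cV[R]_n).

(* Asymptotic stability, in the sense of Lyapunov, of the equilibrium x = 0,
   x' = 0 of x'' = A x' + B x. *)
Definition asymptotically_stable (R : realType) (n : nat) (A B : 'M[R]_n) :
    Prop :=
  lyapunov_stable A B /\ attractive A B.

(* The system x'' = D (A x' + B x) has coefficient matrices D A and D B. *)
Definition D_stable (R : realType) (n : nat) (A B : 'M[R]_n) : Prop :=
  forall D : 'M[R]_n, positive_diagonal D ->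
    asymptotically_stable (D *m A) (D *m B).

(* Main.v *)
Require Import Defs.
From mathcomp Require Import all_boot all_order all_algebra.
From mathcomp Require Import all_classical all_reals all_analysis.
From mathcomp Require Import ring lra.

Set Implicit Arguments.
Unset Strict Implicit.
Unset Printing Implicit Defensive.

Import Order.TTheory GRing.Theory Num.Def Num.Theory.
Import numFieldNormedType.Exports.

Local Open Scope classical_set_scope.
Local Open Scope ring_scope.

(** Let P be the diagonal matrix given by the diagonal stability of A, and let D
be any positive diagonal matrix.  Multiplying x'' = D (A x' + B x) by the
positive diagonal matrix Q = P D^-1 gives Q x'' = P A x' + P B x: a mechanical
system with mass matrix Q, stiffness matrix - P B, which is positive diagonal,
and a force P A x' that dissipates, because the symmetric part of P A is
negative definite.  Everything rests on diagonal matrices commuting: this is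
what makes Q and P B symmetric at the same time.

The energy v^T Q v - x^T P B x, with v = x', has the derivative 2 v^T P A v <= 0
along solutions, which vanishes when v = 0; the energy alone thus shows
stability but not convergence.  Adding the cross term 2 eps x^T Q v with a small
eps > 0 makes the decrease strict in x as well: the derivative of x^T Q v
contains x^T P B x, which is negative, and its other terms, v^T Q v and
x^T P A v, are absorbed by Young's inequality, by the dissipation and by half of
x^T P B x.  For small eps the function V obtained in this way is still
equivalent to |x|^2 + |v|^2, so V' <= - lam V and V decays exponentially
([asymptotically_stable_damped]).  The passage from such a V to asymptotic
stability is [asymptotically_stable_lyapunov].  The quantitative bounds come
from the compactness of the unit sphere ([bil_coercive]). *)

(** * Bilinear forms of real matrices *)

Definition bil (R : realType) (n : nat) (M : 'M[R]_n) (u v : 'cV[R]_n) : R :=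
  (u^T *m M *m v) 0 0.

Section BilinearForms.
Variables (R : realType) (n : nat).
Implicit Types (M N : 'M[R]_n) (u v : 'cV[R]_n).

Lemma bilE M u v : bil M u v = \sum_j \sum_i u i 0 * M i j * v j 0.
Proof.
rewrite /bil mxE; apply: eq_bigr => j _; rewrite mxE mulr_suml.
by apply: eq_bigr => i _; rewrite mxE.
Qed.

Lemma bilDr M u v w : bil M u (v + w) = bil M u v + bil M u w.
Proof. by rewrite /bil mulmxDr mxE. Qed.

Lemma bil_mxD M N u v : bil (M + N) u v = bil M u v + bil N u v.
Proof. by rewrite /bil mulmxDr mulmxDl mxE. Qed.

Lemma bilZZ M (k : R) u : bil M (k *: u) (k *: u) = k ^+ 2 * bil M u u.
Proof. by rewrite /bil -scalemxAr linearZ/= -!scalemxAl !mxE mulrA expr2. Qed.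

Lemma bil0 M : bil M 0 0 = 0.
Proof. by rewrite /bil mulmx0 mxE. Qed.

Lemma bilN M u v : bil (- M) u v = - bil M u v.
Proof. by rewrite /bil mulmxN mulNmx mxE. Qed.

Lemma bil_mulmxr M N u v : bil M u (N *m v) = bil (M *m N) u v.
Proof. by rewrite /bil !mulmxA. Qed.

Lemma bil_trmx M u v : bil M^T u v = bil M v u.
Proof. by rewrite /bil -[u^T *m _ *m v]trmxK mxE !trmx_mul !trmxK mulmxA. Qed.

Lemma bil_sym M u v : M^T = M -> bil M u v = bil M v u.
Proof. by move=> Msym; rewrite -bil_trmx Msym. Qed.

Lemma norm_coord_le (v : 'cV[R]_n) i : `|v i 0| <= `|v|.
Proof. by rewrite [leRHS]/normr/= mx_normrE; exact: (le_bigmax _ _ (i, 0)). Qed.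

Lemma bil_bounded M :
  exists2 k, 0 <= k & forall u v, `|bil M u v| <= k * `|u| * `|v|.
Proof.
exists (\sum_j \sum_i `|M i j|).
  by apply: sumr_ge0 => j _; apply: sumr_ge0.
move=> u v; rewrite bilE -mulrA mulr_suml.
apply: (le_trans (ler_norm_sum _ _ _)); apply: ler_sum => j _.
rewrite mulr_suml; apply: (le_trans (ler_norm_sum _ _ _)).
apply: ler_sum => i _; rewrite !normrM mulrAC mulrC ler_wpM2l//.
by rewrite ler_pM// norm_coord_le.
Qed.

(** The product rule, obtained from that of real functions coordinate by
coordinate. *)
Lemma is_derive_bil M (x y : R -> 'cV[R]_n) (t : R) :
  derivable x t 1 -> derivable y t 1 ->
  is_derive t 1 (fun s => bil M (x s) (y s))
    (bil M (derive1 x t) (y t) + bil M (x t) (derive1 y t)).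
Proof.
move=> dx dy.
have coord (z : R -> 'cV[R]_n) i : derivable z t 1 ->
    is_derive t 1 (fun s => z s i 0) (derive1 z t i 0).
  move=> dz; rewrite derive1E derive_mx// mxE; apply: derivableP.
  exact: (derivable_mxP _ _ _).1.
have -> : (fun s => bil M (x s) (y s)) =
    \sum_(j < n) \sum_(i < n)
      (M i j \*: ((fun s => x s i 0) * (fun s => y s j 0))).
  apply/funext => s; rewrite bilE fct_sumE; apply: eq_bigr => j _.
  rewrite fct_sumE; apply: eq_bigr => i _.
  by rewrite /= fctE mulrAC mulrC.
have dsum := is_derive_sum (fun j => is_derive_sum (fun i =>
  is_deriveZ (M i j) (is_deriveM (coord x i dx) (coord y j dy)))).
apply: is_derive_eq dsum _.
rewrite !bilE -big_split/=; apply: eq_bigr => j _.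
rewrite -big_split/=; apply: eq_bigr => i _.
by rewrite /GRing.scale/=; ring.
Qed.

Lemma norm_trmx (u : 'rV[R]_n) : `|u^T| = `|u|.
Proof.
apply/le_anti; rewrite /normr/= !mx_normrE; apply/andP; split.
  apply: bigmax_le => [|[i j] _]; first exact: bigmax_ge_id.
  by rewrite mxE; exact: (le_bigmax _ _ (j, i)).
apply: bigmax_le => [|[i j] _]; first exact: bigmax_ge_id.
by apply: le_trans (le_bigmax _ _ (j, i)); rewrite mxE.
Qed.

(** A positive definite form attains a positive minimum on the unit sphere,
which is compact; homogeneity carries the bound over to all vectors. *)
Lemma bil_coercive M : (forall v, v != 0 -> 0 < bil M v v) ->
  exists2 c, 0 < c & forall v, c * `|v| ^+ 2 <= bil M v v.
Proof.
move=> Mpos.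
pose f (u : 'rV[R]_n) := bil M u^T u^T.
pose S := [set u : 'rV[R]_n | `|u| = 1].
have fcont : continuous f.
  have -> : f = fun u : 'rV[R]_n => \sum_j \sum_i u 0 i * M i j * u 0 j.
    apply/funext => u; rewrite /f bilE; apply: eq_bigr => j _.
    by apply: eq_bigr => i _; rewrite !mxE.
  apply: continuous_big => [|j _]; first exact: add_continuous.
  apply: continuous_big => [|i _]; first exact: add_continuous.
  have cc k : continuous (fun u : 'rV[R]_n => u 0 k) by exact: coord_continuous.
  by move=> u; exact: (cvgM (cvgM (cc i u) (cvg_cst (M i j))) (cc j u)).
have Scompact : compact S.
  apply: bounded_closed_compact.
    exists 1; split=> [|y y1 u /= ->]; [exact: num_real|exact: ltW].
  have -> : S = normr @^-1` [set 1] by [].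
  apply: preimage_closed; last exact: closed_eq.
  by move=> u _; exact: norm_continuous.
have unit_sphere (v : 'cV[R]_n) : v != 0 -> S (`|v|^-1 *: v^T).
  move=> v0; rewrite /S/= normrZ normrV ?unitfE ?normr_eq0// normr_id.
  by rewrite -norm_trmx trmxK mulVf ?normr_eq0.
(* The sphere is empty when n = 0. *)
have [S0|S0] := pselect (S !=set0); last first.
  exists 1 => // v; have [->|v0] := eqVneq v 0.
    by rewrite normr0 expr0n mulr0 bil0.
  by case: S0; eexists; exact: unit_sphere v0.
have [w Sw fmin] := EVT_min_rV S0 Scompact (continuous_subspaceT fcont).
exists (f w).
  apply: Mpos; rewrite -normr_eq0 norm_trmx; move: Sw; rewrite inE /S/= => ->.
  exact: oner_neq0.
move=> v; have [->|v0] := eqVneq v 0.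
  by rewrite normr0 expr0n mulr0 bil0.
have := fmin _ (mem_set (unit_sphere v v0)).
rewrite {2}/f linearZ/= trmxK bilZZ exprVn mulrC ler_pdivlMr//.
by rewrite exprn_gt0// normr_gt0.
Qed.

End BilinearForms.

(** * Exponential decay and asymptotic stability *)

(** Gronwall's argument: f(t) exp(lam t) has a nonpositive derivative. *)
Lemma exp_decay (R : realType) (f df : R -> R) (lam : R) :
  (forall t : R, is_derive t 1 f (df t)) -> (forall t, df t <= - lam * f t) ->
  forall t, 0 <= t -> f t <= f 0 * expR (- (lam * t)).
Proof.
move=> fdf fle t t0.
pose g := f * (expR \o (lam \*: id)).
have dg (s : R) : is_derive s 1 g
    (f s *: (expR (lam * s) * (lam *: 1)) + expR (lam * s) *: df s).
  have de : is_derive s 1 (expR \o (lam \*: id))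
      (expR (lam * s) * (lam *: 1)).
    exact: is_derive1_comp.
  exact: is_deriveM.
have g_le : g t <= g 0.
  have g_derivable s : derivable g s 1.
    exact: (@ex_derive _ _ _ _ _ _ _ (dg s)).
  apply: (@ler0_derive1_le_cc _ g 0 t) => // [s _|||].
  - rewrite derive1E (@derive_val _ _ _ _ _ _ _ (dg s)).
    have := ler_wpM2l (expR_ge0 (lam * s)) (fle s).
    by rewrite /GRing.scale/=; lra.
  - apply: continuous_subspaceT => s; apply/differentiable_continuous.
    exact/derivable1_diffP.
  - by rewrite in_itv/= lexx t0.
  - by rewrite in_itv/= lexx t0.
move: g_le; rewrite /g !fctE /= /GRing.scale/= mulr0 expR0 mulr1 => g_le.
by rewrite expRN ler_pdivlMr// expR_gt0.
Qed.

(** The estimate is homogeneous in the initial phase and uniform over all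
solutions, so it bounds them (Lyapunov stability) and makes them vanish at
infinity (attractivity, here with basin radius 1, an arbitrary choice). *)
Lemma asymptotically_stable_exp_decay (R : realType) (n : nat)
    (A B : 'M[R]_n) (C lam : R) : 0 <= C -> 0 < lam ->
  (forall x, solution A B x -> forall t, 0 <= t ->
    `|phase x t| ^+ 2 <= C * `|phase x 0| ^+ 2 * expR (- (lam * t))) ->
  asymptotically_stable A B.
Proof.
move=> C0 lam0 decay; split.
  (* This delta works because C < (1 + C) ^+ 2. *)
  move=> eps eps0; exists (eps / (1 + C)); first by rewrite divr_gt0//; lra.
  move=> x solx x0 t t0.
  rewrite -(@ltr_pXn2r _ 2)// ?nnegrE// ?ltW//.
  apply: (le_lt_trans (decay x solx t t0)).
  have e1 : expR (- (lam * t)) <= 1.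
    by rewrite -expR0 ler_expR oppr_le0 mulr_ge0// ltW.
  have p2 : `|phase x 0| ^+ 2 <= (eps / (1 + C)) ^+ 2.
    by rewrite ler_pXn2r ?nnegrE// ?ltW// divr_gt0//; lra.
  apply: (@le_lt_trans _ _ (C * (eps / (1 + C)) ^+ 2)).
    rewrite -[leRHS]mulr1 ler_pM ?expR_ge0 ?mulr_ge0 ?sqr_ge0//.
    by rewrite ler_wpM2l.
  rewrite expr_div_n mulrA ltr_pdivrMr ?exprn_gt0//; last by lra.
  have : 0 < eps ^+ 2 by rewrite exprn_gt0.
  nra.
exists 1 => // x solx _.
apply: (@norm_cvg0 _ _ _ _ _ _); apply/cvgr0Pnorm_lt => e e0.
pose C' := C * `|phase x 0| ^+ 2.
have C'0 : 0 <= C' by rewrite mulr_ge0// sqr_ge0.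
have d0 : 0 < e ^+ 2 / (1 + C') by rewrite divr_gt0 ?exprn_gt0//; lra.
have ecvg : expR (- (lam * t)) @[t --> +oo] --> (0 : R).
  have lcvg : lam * t @[t --> +oo] --> +oo by exact: gt0_cvgMry.
  exact: (cvg_comp _ _ lcvg (@cvgr_expR R)).
near=> t.
rewrite normr_id -(@ltr_pXn2r _ 2)// ?nnegrE// ?ltW//.
apply: (le_lt_trans (decay x solx t _)).
  by near: t; exact: nbhs_pinfty_ge.
have et : expR (- (lam * t)) < e ^+ 2 / (1 + C').
  rewrite -[ltLHS]ger0_norm ?expR_ge0//; near: t.
  exact: (cvgr0_norm_lt _ ecvg).
rewrite -/C'; move: et; rewrite ltr_pdivlMr; last by lra.
by have := expR_gt0 (- (lam * t)); lra.
Unshelve. all: by end_near. Qed.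

(** * Strict quadratic Lyapunov functions *)

(** V is equivalent to the square of the norm of the phase and its derivative
along solutions is at most - (r / C) V, so V, hence the phase, decays
exponentially. *)
Lemma asymptotically_stable_lyapunov (R : realType) (n : nat) (A B : 'M[R]_n)
    (V dV : 'cV[R]_n -> 'cV[R]_n -> R) (m C r : R) :
  0 < m -> 0 < C -> 0 < r ->
  (forall x v, m * (`|x| ^+ 2 + `|v| ^+ 2) <= V x v) ->
  (forall x v, V x v <= C * (`|x| ^+ 2 + `|v| ^+ 2)) ->
  (forall x v, dV x v <= - r * (`|x| ^+ 2 + `|v| ^+ 2)) ->
  (forall x, solution A B x -> forall t : R,
    is_derive t 1 (fun u => V (x u) (derive1 x u)) (dV (x t) (derive1 x t))) ->
  asymptotically_stable A B.
Proof.
move=> m_gt0 C_gt0 r_gt0 Vge Vle dVle derV.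
pose N (x v : 'cV[R]_n) := `|x| ^+ 2 + `|v| ^+ 2.
have lam_gt0 : 0 < r / C by rewrite divr_gt0.
apply: (@asymptotically_stable_exp_decay _ _ _ _ (2 * C / m) (r / C)) => //.
  by rewrite divr_ge0//; lra.
move=> x solx t t0.
have dec (u : R) : dV (x u) (derive1 x u) <= - (r / C) * V (x u) (derive1 x u).
  apply: (le_trans (dVle _ _)).
  rewrite !mulNr lerN2 -mulrA ler_wpM2l ?(ltW r_gt0)//.
  by rewrite ler_pdivrMl.
have V_decay := exp_decay (derV x solx) dec t0.
have phaseE (u : R) : `|phase x u| = Num.max `|x u| `|derive1 x u| by [].
have phase_le (u : R) : `|phase x u| ^+ 2 <= N (x u) (derive1 x u).
  by rewrite phaseE /N /Num.max; case: ifP => _; rewrite ?lerDr ?lerDl sqr_ge0.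
have phase_ge (u : R) : N (x u) (derive1 x u) <= 2 * `|phase x u| ^+ 2.
  rewrite mulr_natl mulr2n phaseE /N.
  by apply: lerD; rewrite ler_pXn2r ?nnegrE ?le_max ?lexx ?orbT ?normr_ge0.
apply: (le_trans (phase_le t)).
rewrite -(ler_pM2l m_gt0); apply: (le_trans (Vge _ _)).
apply: (le_trans V_decay).
rewrite mulrA ler_wpM2r ?expR_ge0//.
apply: (le_trans (Vle _ _)).
have -> : m * (2 * C / m * `|phase x 0| ^+ 2) = C * (2 * `|phase x 0| ^+ 2).
  by field; rewrite gt_eqF.
by apply: ler_wpM2l (phase_ge 0); exact: ltW.
Qed.

(** This is the case of a system Q x'' = (Q A) x' + (Q B) x with mass Q,
stiffness - Q B and a dissipative force (Q A) x', where the Lyapunov function is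
the energy plus a cross term 2 eps x^T Q v.  The constant eps is small in three
respects: two of them keep V positive definite, the third lets the dissipation
c |v|^2 absorb the terms in |v|^2 that the cross term produces. *)
Lemma asymptotically_stable_damped (R : realType) (n : nat)
    (A B Q : 'M[R]_n) : Q^T = Q -> (Q *m B)^T = Q *m B ->
  (forall v, v != 0 -> 0 < bil Q v v) ->
  (forall v, v != 0 -> bil (Q *m B) v v < 0) ->
  (forall v, v != 0 -> bil (Q *m A) v v < 0) ->
  asymptotically_stable A B.
Proof.
move=> Qsym QBsym Qpos QBneg QAneg.
have [q0 q0_gt0 hq0] := bil_coercive Qpos.
have [k0 k0_gt0 hk0] : exists2 c, 0 < c &
    forall v, c * `|v| ^+ 2 <= bil (- (Q *m B)) v v.
  by apply: bil_coercive => v v0; rewrite bilN oppr_gt0 QBneg.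
have [c c_gt0 hc] : exists2 c, 0 < c &
    forall v, c * `|v| ^+ 2 <= bil (- (Q *m A)) v v.
  by apply: bil_coercive => v v0; rewrite bilN oppr_gt0 QAneg.
have [q q_ge0 hq] := bil_bounded Q.
have [k k_ge0 hk] := bil_bounded (Q *m B).
have [l l_ge0 hl] := bil_bounded (Q *m A).
(* Young's inequality turns the terms v^T Q v and x^T Q A v of the derivative of
   the cross term into at most s |v|^2 + (k0 / 2) |x|^2. *)
pose s := q + l ^+ 2 / (2 * k0).
have s_ge0 : 0 <= s by rewrite addr_ge0// divr_ge0 ?sqr_ge0//; lra.
have [eps eps_gt0 [eq eqk es]] : exists2 eps, 0 < eps &
    [/\ eps * q <= q0 / 2, eps * q <= k0 / 2 & eps * s <= c / 2].
  have [d d_gt0 [d1 d2 d3]] : exists2 d, 0 < d &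
      [/\ d <= q0 / 2, d <= k0 / 2 & d <= c / 2].
    exists (Num.min (q0 / 2) (Num.min (k0 / 2) (c / 2))).
      by rewrite !lt_min; apply/and3P; split; lra.
    by split; rewrite !ge_min lexx ?orbT.
  exists (d / (1 + q + s)); first by rewrite divr_gt0//; lra.
  have small r : 0 <= r -> r <= 1 + q + s -> d / (1 + q + s) * r <= d.
    move=> r0 r1; rewrite mulrAC ler_pdivrMr; last by lra.
    by rewrite ler_wpM2l// ltW.
  by split; [apply: le_trans d1|apply: le_trans d2|apply: le_trans d3];
    apply: small => //; lra.
pose V (x v : 'cV[R]_n) :=
  bil Q v v - bil (Q *m B) x x + 2 * eps * bil Q x v.
pose dV (x v : 'cV[R]_n) := 2 * (bil (Q *m A) v v +
  eps * (bil Q v v + bil (Q *m A) x v + bil (Q *m B) x x)).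
pose N (x v : 'cV[R]_n) := `|x| ^+ 2 + `|v| ^+ 2.
have bil_le M K : (forall u v : 'cV[R]_n, `|bil M u v| <= K * `|u| * `|v|) ->
    forall u, `|bil M u u| <= K * `|u| ^+ 2.
  by move=> hM u; rewrite expr2 mulrA.
have cross_small x v : `|2 * eps * bil Q x v| <=
    k0 / 2 * `|x| ^+ 2 + q0 / 2 * `|v| ^+ 2.
  have := ler_wpM2l (ltW eps_gt0) (hq x v).
  have := ler_wpM2r (sqr_ge0 `|x|) eqk; have := ler_wpM2r (sqr_ge0 `|v|) eq.
  have := mulr_ge0 (mulr_ge0 (ltW eps_gt0) q_ge0) (sqr_ge0 (`|x| - `|v|)).
  rewrite normrM ger0_norm; last by lra.
  lra.
have [m m_gt0 Vge] : exists2 m, 0 < m & forall x v, m * N x v <= V x v.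
  exists (Num.min (q0 / 2) (k0 / 2)).
    by rewrite lt_min; apply/andP; split; lra.
  move=> x v; set m := Num.min _ _.
  have mq : m <= q0 / 2 by rewrite ge_min lexx.
  have mk : m <= k0 / 2 by rewrite ge_min lexx orbT.
  have := hq0 v; have := hk0 x; have := cross_small x v.
  rewrite bilN ler_norml /V /N => /andP[cross _] hx hv.
  have := ler_wpM2r (sqr_ge0 `|x|) mk; have := ler_wpM2r (sqr_ge0 `|v|) mq.
  lra.
have [C C_gt0 Vle] : exists2 C, 0 < C & forall x v, V x v <= C * N x v.
  exists (q + k + q0 + k0) => [|x v]; first by lra.
  have := bil_le _ _ hq v; have := bil_le _ _ hk x; have := cross_small x v.
  rewrite !ler_norml /V /N => /andP[_ cross] /andP[hx _] /andP[_ hv].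
  have C_x : 0 <= (q + q0 + k0 / 2) * `|x| ^+ 2.
    by rewrite mulr_ge0 ?sqr_ge0//; lra.
  have C_v : 0 <= (k + k0 + q0 / 2) * `|v| ^+ 2.
    by rewrite mulr_ge0 ?sqr_ge0//; lra.
  lra.
have [r r_gt0 dVle] : exists2 r, 0 < r & forall x v, dV x v <= - r * N x v.
  exists (Num.min c (eps * k0)).
    by rewrite lt_min c_gt0 mulr_gt0.
  move=> x v; set r := Num.min _ _.
  have rc : r <= c by rewrite ge_min lexx.
  have rk : r <= eps * k0 by rewrite ge_min lexx orbT.
  have young : l * `|x| * `|v| <=
      k0 / 2 * `|x| ^+ 2 + l ^+ 2 / (2 * k0) * `|v| ^+ 2.
    rewrite -subr_ge0; set rhs := (X in 0 <= X).
    have -> : rhs = (k0 * `|x| - l * `|v|) ^+ 2 / (2 * k0).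
      by rewrite /rhs; field; rewrite gt_eqF.
    by rewrite divr_ge0 ?sqr_ge0//; lra.
  have Qle : bil Q v v + bil (Q *m A) x v + bil (Q *m B) x x <=
      s * `|v| ^+ 2 - k0 / 2 * `|x| ^+ 2.
    have := bil_le _ _ hq v; have := hl x v; have := hk0 x.
    rewrite bilN !ler_norml /s => hx /andP[_ hxv] /andP[_ hv].
    lra.
  have := ler_wpM2l (ltW eps_gt0) Qle; have := ler_wpM2r (sqr_ge0 `|v|) es.
  have := ler_wpM2r (sqr_ge0 `|x|) rk; have := ler_wpM2r (sqr_ge0 `|v|) rc.
  have := hc v; rewrite bilN /dV /N.
  lra.
apply: (asymptotically_stable_lyapunov m_gt0 C_gt0 r_gt0 Vge Vle dVle).
move=> x solx u.
have [dx ddx eqx] := solx u.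
have d1 := is_derive_bil Q ddx ddx.
have d2 := is_derive_bil (Q *m B) dx dx.
have d3 := is_derive_bil Q dx ddx.
apply: (is_derive_eq
  (is_deriveD (is_deriveB d1 d2) (is_deriveZ (2 * eps) d3))).
rewrite eqx (bil_sym _ _ Qsym) !bilDr !bil_mulmxr (bil_sym _ (x u) QBsym).
by rewrite /dV /GRing.scale/=; ring.
Qed.

(** * Diagonal matrices and D-stability *)

Lemma positive_diagonalP (R : realType) (n : nat) (D : 'M[R]_n) :
  positive_diagonal D -> exists2 d, D = diag_mx d & forall i, 0 < d 0 i.
Proof.
move=> [/diag_mxP[d ->] dpos]; exists d => // i.
by have := dpos i; rewrite mxE eqxx mulr1n.
Qed.

Lemma bil_diag_gt0 (R : realType) (n : nat) (d : 'rV[R]_n) (v : 'cV[R]_n) :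
  (forall i, 0 < d 0 i) -> v != 0 -> 0 < bil (diag_mx d) v v.
Proof.
move=> dpos v0.
have -> : bil (diag_mx d) v v = \sum_i d 0 i * v i 0 ^+ 2.
  rewrite /bil mxE; apply: eq_bigr => i _.
  by rewrite mul_mx_diag !mxE mulrAC -expr2 mulrC.
have /existsP[i vi] : [exists i, v i 0 != 0].
  apply: contraNT v0; rewrite negb_exists => /forallP v0.
  by apply/eqP/colP => i; rewrite mxE; apply/eqP; rewrite -[_ == _]negbK v0.
rewrite (bigD1 i)//= ltr_pwDl//.
  by rewrite mulr_gt0// lt_def sqrf_eq0 vi sqr_ge0.
by apply: sumr_ge0 => j _; rewrite mulr_ge0 ?sqr_ge0// ltW.
Qed.

Theorem theorem10 (R : realType) (n : nat) (A B : 'M[R]_n) :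
  diagonally_stable A -> negative_diagonal B -> D_stable A B.
Proof.
move=> [P [/positive_diagonalP[p -> p_gt0] [_ PA_neg]]] [/diag_mxP[b ->] B_neg].
move=> D /positive_diagonalP[d -> d_gt0].
have b_lt0 i : b 0 i < 0 by have := B_neg i; rewrite mxE eqxx mulr1n.
(* The mass matrix P D^-1. *)
pose q : 'rV[R]_n := \row_i (p 0 i / d 0 i).
have qd : diag_mx q *m diag_mx d = diag_mx p.
  rewrite mulmx_diag; congr diag_mx; apply/rowP => i.
  by rewrite !mxE divfK// gt_eqF.
apply: (@asymptotically_stable_damped _ _ _ _ (diag_mx q)).
- exact: tr_diag_mx.
- by rewrite mulmxA qd mulmx_diag tr_diag_mx.
- by move=> v; apply: bil_diag_gt0 => i; rewrite mxE divr_gt0.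
- move=> v v0; rewrite mulmxA qd mulmx_diag -oppr_gt0 -bilN -raddfN/=.
  by apply: bil_diag_gt0 => // i; rewrite !mxE oppr_gt0 pmulr_rlt0.
- move=> v v0; rewrite mulmxA qd.
  (* P A and its transpose A^T P define the same quadratic form. *)
  have := PA_neg v v0; rewrite -/(bil _ v v) bil_mxD.
  by rewrite -[X in A^T *m X]tr_diag_mx -trmx_mul bil_trmx; lra.
Qed.
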